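(* Let $M,N,K,L\ge 1$ be integers with $M\ge K$, $N\ge K$, $L\ge M$, $L\ge N$. Let $\mathbf{R}_{\mathrm T}\in\mathbb{C}^{M\times M}$ be Hermitian positive definite, let $\mathbf{S}=[\mathbf{s}_1\cdots\mathbf{s}_L]\in\mathbb{C}^{M\times L}$ be a fixed radar waveform, and put $\varrho_l^2=1+|\mathbf{s}_l^{\mathsf H}\mathbf{R}_{\mathrm T}\mathbf{s}_l|$ for $l=1,\dots,L$. Let $\mathbf{H}_{\mathrm u}=[\mathbf{h}_{1}\cdots\mathbf{h}_{K}]\in\mathbb{C}^{N\times K}$ have independent columns $\mathbf{h}_{k}\sim\mathcal{CN}(\mathbf{0},\mathbf{I}_N)$. For $p_{\mathrm c}>0$ let the uplink sum communication rate be $$\mathcal{R}_{\mathrm u}(p_{\mathrm c})=\frac1L\sum_{l=1}^{L}\log_2\det\big(\mathbf{I}_N+p_{\mathrm c}\varrho_l^{-2}\mathbf{H}_{\mathrm u}\mathbf{H}_{\mathrm u}^{\mathsf H}\big),$$ and for a fixed target rate $\mathcal{R}>0$ let $P_{\mathrm u}(p_{\mathrm c})=\Pr(\mathcal{R}_{\mathrm u}(p_{\mathrm c})<\mathcal{R})$. Then $$P_{\mathrm u}(p_{\mathrm c})=\mathcal{O}\big(p_{\mathrm c}^{-NK}\big)\qquad\text{as }p_{\mathrm c}\to\infty.$$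
   Context: $\mathcal{CN}(\mathbf{0},\mathbf{I}_N)$ denotes the standard circularly symmetric complex Gaussian distribution on $\mathbb{C}^N$; $(\cdot)^{\mathsf H}$ is the conjugate transpose. The base station has $M$ transmit and $N$ receive antennas and receives uplink signals of $K$ single-antenna users, while treating the reflected radar signal at time slot $l$ plus noise as Gaussian noise with covariance $\varrho_l^2\mathbf{I}_N$; $p_{\mathrm c}$ is the communication SNR. The $\mathcal{O}$ constant may depend on everything except $p_{\mathrm c}$. *)

(* Defs.v *)
From mathcomp Require Import all_boot all_order all_algebra.
From mathcomp Require Import all_classical all_reals all_analysis.
From mathcomp Require Import complex.

Set Implicit Arguments.
Unset Strict Implicit.
Unset Printing Implicit Defensive.

Import Order.TTheory GRing.Theory Num.Theory.
Import numFieldNormedType.Exports.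

Local Open Scope classical_set_scope.
Local Open Scope ring_scope.
Local Open Scope sesquilinear_scope.
Local Open Scope complex_scope.

(* The library has no such instance; Landau notations along +oo need it. *)
Canonical pinfty_filter_on (R : numFieldType) :=
  FilterType (pinfty_nbhs R) (@filter_filter R _ proper_pinfty_nbhs).

Definition log2 (R : realType) (x : R) : R := ln x / ln 2.

(* On R[i], [0 < z] means that z is real and positive. *)
Definition hermitian_posdef (C : numClosedFieldType) (n : nat) (A : 'M[C]_n) :
    Prop :=
  A \is hermsymmx /\
  forall x : 'cV[C]_n, x != 0 -> 0 < (x ^t* *m A *m x) 0 0.

Definition mutually_independent (d : measure_display) (T : measurableType d)
    (R : realType) (P : probability T R) (I : finType)
    (G : I -> set_system T) : Prop :=
  forall (J : {set I}) (E : I -> set T), (forall i, G i (E i)) ->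
    P (\bigcap_(i in [set i | i \in J]) E i) = (\prod_(i in J) P (E i))%E.

(* Identification of C^n with R^(2n): the index (i, false) is the real part and
   (i, true) the imaginary part of the i-th entry. *)
Definition real_coord (R : realType) (n : nat) (j : 'I_n * bool)
    (z : 'cV[R[i]]_n) : R :=
  if j.2 then complex.Im (z j.1 0) else complex.Re (z j.1 0).

(* The Borel sigma-algebra of C^n is the product of 2n copies of that of R, so
   this is the sigma-algebra generated by the random vector h. *)
Definition g_sigma_cvect (T : Type) (R : realType) (n : nat)
    (h : T -> 'cV[R[i]]_n) : set_system T :=
  <<s \bigcup_(j : 'I_n * bool)
        preimage_set_system setT (real_coord j \o h) measurable >>.

(* h ~ CN(0, I_n): the 2n real coordinates are independent N(0, 1/2) random
   variables; the second parameter of normal_prob is the standard deviation. *)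
Definition standard_complex_normal (d : measure_display) (T : measurableType d)
    (R : realType) (P : probability T R) (n : nat) (h : T -> 'cV[R[i]]_n) :
    Prop :=
  [/\ forall j, measurable_fun [set: T] (real_coord j \o h),
      forall j (A : set R), measurable A ->
        P ((real_coord j \o h) @^-1` A) = normal_prob 0 (Num.sqrt (2^-1)) A &
      mutually_independent P
        (fun j => preimage_set_system setT (real_coord j \o h) measurable)].

Definition noise_var (R : realType) (M : nat) (RT : 'M[R[i]]_M)
    (s : 'cV[R[i]]_M) : R :=
  1 + Normc.normc ((s ^t* *m RT *m s) 0 0).

(* The determinant below is real and positive for p > 0, hence the real part. *)
Definition uplink_rate (R : realType) (M N K L : nat) (RT : 'M[R[i]]_M)
    (S : 'M[R[i]]_(M, L)) (Hu : 'M[R[i]]_(N, K)) (p : R) : R :=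
  L%:R^-1 * \sum_(l < L)
    log2 (complex.Re
      (\det (1%:M + (p * (noise_var RT (col l S))^-1)%:C *: (Hu *m Hu ^t*)))).

Definition uplink_outage (d : measure_display) (T : measurableType d)
    (R : realType) (P : probability T R) (M N K L : nat) (RT : 'M[R[i]]_M)
    (S : 'M[R[i]]_(M, L)) (Hu : T -> 'M[R[i]]_(N, K)) (r p : R) : R :=
  fine (P [set w | uplink_rate RT S (Hu w) p < r]).

(* Main.v *)
(* The eigenvalues of A A^H are nonnegative, so det(I + a A A^H) >= 1 + a |A|_F^2
   for a >= 0. All summands of the rate are therefore nonnegative, and if the
   rate is below r then, looking at a single time slot l,
   |H|_F^2 <= 2^(L r) rho_l^2 / p. Hence in outage each of the 2NK real coordinates
   of H lies in an interval of length O(p^(-1/2)); the coordinates are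
   independent with bounded density, so this has probability O(p^(-NK)). *)

Require Import Defs.
From mathcomp Require Import all_boot all_order all_algebra.
From mathcomp Require Import all_classical all_reals all_analysis.
From mathcomp Require Import complex measurable_realfun ring.

Import Order.TTheory GRing.Theory Num.Theory.
Import numFieldNormedType.Exports.

Local Open Scope classical_set_scope.
Local Open Scope ring_scope.

(** * Lower bound for the determinant of the identity plus a Gram matrix *)

Section determinant_bound.
Local Open Scope sesquilinear_scope.
Variable C : numClosedFieldType.

(** The remaining terms of the expanded product are nonnegative. In the induction, the tail product
    is at least 1, so multiplying [x i] by it can only increase it. *)
Lemma prodr_1D_ge_sum (I : finType) (x : I -> C) : (forall i, 0 <= x i) ->
  1 + \sum_i x i <= \prod_i (1 + x i).
Proof.
move=> x0; elim: (index_enum I) => [|i s IH]; first by rewrite !big_nil addr0.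
rewrite !big_cons mulrDl mul1r addrCA addrC lerD//.
by rewrite ler_peMr// (le_trans _ IH)// lerDl sumr_ge0.
Qed.

Lemma mulmx_trC_diag m n (A : 'M[C]_(m, n)) i :
  (A *m A ^t*) i i = \sum_j `|A i j| ^+ 2.
Proof. by rewrite mxE; apply: eq_bigr => j _; rewrite !mxE normCK. Qed.

(** In a unitary diagonalization of the Gram matrix with eigenvalues [d 0 i], the determinant is the
    product of the [1 + a * d 0 i] and the trace is the sum of the [d 0 i], so [prodr_1D_ge_sum]
    applies. *)
Lemma det_1D_gram_ge m n (a : C) (A : 'M[C]_(m, n)) : 0 <= a ->
  1 + a * \tr (A *m A ^t*) <= \det (1%:M + a *: (A *m A ^t*)).
Proof.
move=> a0; set G := A *m A ^t*.
(* [G] equals its own conjugate transpose, hence commutes with it; normality is what the spectral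
   theorem asks for. *)
have Gnormal : G \is normalmx.
  apply/normalmxP.
  by rewrite /G !trmx_mul !map_mxM map_trmx trmxK -map_mx_comp
    (map_mx_id (@conjCK _)).
have [U [d [Uunitary GE]]] : exists (U : 'M[C]_m) d, U \is unitarymx /\
    G = invmx U *m diag_mx d *m U.
  exists (spectralmx G), (spectral_diag G); split; first exact: spectral_unitarymx.
  exact/orthomx_spectralP.
have Uunit := unitarymx_unit Uunitary.
have d_ge0 i : 0 <= d 0 i.
  (* Conjugating [G] by [U] gives the Gram matrix of [U *m A], so each eigenvalue is the squared
     norm of a row of [U *m A]. *)
  have -> : d 0 i = ((U *m A) *m (U *m A) ^t*) i i.
    rewrite trmx_mul map_mxM -mulmxA (mulmxA A) -/G GE -invmx_unitary//.
    rewrite !mulmxA mulmxV// mul1mx -mulmxA mulmxV// mulmx1.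
    by rewrite mxE eqxx.
  by rewrite mulmx_trC_diag sumr_ge0// => j _; rewrite exprn_ge0.
have -> : \tr G = \sum_i d 0 i.
  by rewrite GE mxtrace_mulC mulmxA mulmxV// mul1mx mxtrace_diag.
have -> : 1%:M + a *: G =
    invmx U *m diag_mx (\row_i (1 + a * d 0 i)) *m U.
  have -> : diag_mx (\row_i (1 + a * d 0 i)) = 1%:M + a *: diag_mx d.
    apply/matrixP => i j; rewrite !mxE.
    by case: eqVneq => _; rewrite ?mulr1n ?mulr0n ?mulr0 ?addr0.
  by rewrite mulmxDr mulmxDl mulmx1 mulVmx// -scalemxAr -scalemxAl GE.
rewrite !det_mulmx mulrAC -det_mulmx mulVmx// det1 mul1r det_diag.
rewrite mulr_sumr; under [leRHS]eq_bigr do rewrite mxE.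
by apply: prodr_1D_ge_sum => i; rewrite mulr_ge0.
Qed.

End determinant_bound.

(** * Probability that independent Gaussian coordinates are all small *)

Section probability_bounds.
Local Open Scope ereal_scope.
Context {d : measure_display} {T : measurableType d} {R : realType}.
Implicit Types P : probability T R.

(** Independence is applied to the full index set. This serves at two levels: for the real
    coordinates of one column, and for the columns of the matrix. *)
Lemma mutually_independent_bigcap_le P (I : finType) (G : I -> set_system T)
    (E : I -> set T) (b : R) : (0 <= b)%R ->
  mutually_independent P G -> (forall i, G i (E i)) ->
  (forall i, P (E i) <= b%:E) -> P (\bigcap_i E i) <= (b ^+ #|I|)%:E.
Proof.
move=> b0 indG GE Eb.
have := indG finset.setT E GE.
rewrite (_ : \bigcap_(i in _) E i = \bigcap_i E i); last first.
  by congr bigcap; apply/seteqP; split => i //= _; rewrite inE.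
move=> ->; rewrite (eq_bigl xpredT) => [|i]; last by rewrite finset.in_setT.
rewrite -big_enum cardE; elim: (enum I) => [|i s IH].
  by rewrite big_nil expr0.
rewrite big_cons/= exprS EFinM lee_pmul//.
by elim/big_ind: _ => // x y; exact: mule_ge0.
Qed.

(** The density is at most its peak value, and the interval has length [2 * c]. *)
Lemma normal_prob_itv_le (s c : R) : s != 0%R -> (0 <= c)%R ->
  normal_prob 0 s `[(- c)%R, c] <= (2 * c * normal_peak s)%:E.
Proof.
move=> s0 c0; rewrite /normal_prob.
apply: (@le_trans _ _
    (\int[lebesgue_measure]_(x in `[(- c)%R, c]) (normal_peak s)%:E)).
  apply: ge0_le_integral => //.
  - by move=> x _; rewrite lee_fin normal_pdf_ge0.
  - apply/measurable_EFinP/measurable_funTS; exact: measurable_normal_pdf.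
  - by move=> x _; rewrite lee_fin normal_pdf_ub.
rewrite integral_cst//= lebesgue_measure_itv/= lte_fin.
(* The length formula distinguishes whether [- c < c]; the other case is the degenerate interval
   with [c = 0], of measure zero. *)
case: ifPn => _; last first.
  by rewrite mule0 lee_fin !mulr_ge0 // normal_peak_ge0.
by rewrite -EFinD -EFinM lee_fin opprK -mulr2n -(mulr_natl c) mulrC.
Qed.

(** A ball for the sup norm of the real coordinates rather than a Euclidean one: its preimage is an
    intersection of events on single coordinates, to which independence applies directly. *)
Definition coord_box n (c : R) : set 'cV[R[i]]_n :=
  [set z | forall j, (`|real_coord j z| <= c)%R].

Lemma preimage_coord_boxE n (c : R) (h : T -> 'cV[R[i]]_n) :
  h @^-1` coord_box n c = \bigcap_j ((real_coord j \o h) @^-1` `[(- c)%R, c]).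
Proof.
apply/seteqP; split => [w hw j _|w hw j] /=; first by rewrite in_itv/= -ler_norml.
by have := hw j I; rewrite /= in_itv/= -ler_norml.
Qed.

(** Independence of the columns is stated for events of these sigma-algebras, so the box events must
    be shown to belong to them. *)
Lemma g_sigma_cvect_coord_box n (c : R) (h : T -> 'cV[R[i]]_n) :
  g_sigma_cvect h (h @^-1` coord_box n c).
Proof.
rewrite preimage_coord_boxE /g_sigma_cvect.
set G := (X in <<s X >>).
apply: (@fin_bigcap_measurable _ (g_sigma_algebraType G)) => // j _.
apply: sub_sigma_algebra; exists j => //.
by exists `[(- c)%R, c]%classic => //; rewrite setTI.
Qed.

Lemma standard_complex_normal_coord_box_le P n (c : R) (h : T -> 'cV[R[i]]_n) :
    (0 <= c)%R -> standard_complex_normal P h ->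
  P (h @^-1` coord_box n c)
    <= ((2 * c * normal_peak (Num.sqrt (2^-1))) ^+ (n * 2))%:E.
Proof.
move=> c0 [_ hdist hindep]; rewrite preimage_coord_boxE.
have <- : #|{: 'I_n * bool}| = (n * 2)%N by rewrite card_prod card_ord card_bool.
apply: mutually_independent_bigcap_le hindep _ _.
- by rewrite !mulr_ge0// normal_peak_ge0.
- by move=> j; exists `[(- c)%R, c]%classic => //; rewrite setTI.
- move=> j; rewrite hdist//; exact: normal_prob_itv_le.
Qed.

End probability_bounds.

(** * Measurability of complex-valued functions through real and imaginary parts *)

Section complex_measurability.
Context {d : measure_display} {T : measurableType d} {R : realType}.
Implicit Types f g : T -> R[i].

Definition measurable_cfun f :=
  measurable_fun setT (fun w => complex.Re (f w)) /\
  measurable_fun setT (fun w => complex.Im (f w)).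

Lemma measurable_cfun_cst z : measurable_cfun (fun=> z).
Proof. by split; exact: measurable_cst. Qed.

Lemma measurable_cfunD f g : measurable_cfun f -> measurable_cfun g ->
  measurable_cfun (fun w => f w + g w).
Proof.
move=> [fr fi] [gr gi]; split.
  rewrite (_ : (fun _ => _) = (fun w => complex.Re (f w) + complex.Re (g w))).
    exact: measurable_funD.
  by apply/funext => w; case: (f w) (g w) => ? ? [].
rewrite (_ : (fun _ => _) = (fun w => complex.Im (f w) + complex.Im (g w))).
  exact: measurable_funD.
by apply/funext => w; case: (f w) (g w) => ? ? [].
Qed.

Lemma measurable_cfunM f g : measurable_cfun f -> measurable_cfun g ->
  measurable_cfun (fun w => f w * g w).
Proof.
move=> [fr fi] [gr gi]; split.
  rewrite (_ : (fun _ => _) = (fun w => complex.Re (f w) * complex.Re (g w) -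
      complex.Im (f w) * complex.Im (g w))).
    by apply: measurable_funB; exact: measurable_funM.
  by apply/funext => w; case: (f w) (g w) => ? ? [].
rewrite (_ : (fun _ => _) = (fun w => complex.Re (f w) * complex.Im (g w) +
    complex.Im (f w) * complex.Re (g w))).
  by apply: measurable_funD; exact: measurable_funM.
by apply/funext => w; case: (f w) (g w) => ? ? [].
Qed.

Lemma measurable_cfun_conj f : measurable_cfun f ->
  measurable_cfun (fun w => (f w)^*).
Proof.
move=> [fr fi]; split.
  by rewrite (_ : (fun _ => _) = (fun w => complex.Re (f w)))//;
    apply/funext => w; case: (f w).
rewrite (_ : (fun _ => _) = (fun w => - complex.Im (f w))).
  exact: measurable_funN.
by apply/funext => w; case: (f w).
Qed.

Lemma measurable_cfun_sum (I : Type) (s : seq I) (F : I -> T -> R[i]) :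
  (forall i, measurable_cfun (F i)) ->
  measurable_cfun (fun w => \sum_(i <- s) F i w).
Proof.
move=> mF; elim: s => [|i s IH].
  under eq_fun do rewrite big_nil; exact: measurable_cfun_cst.
under eq_fun do rewrite big_cons; exact: measurable_cfunD.
Qed.

Lemma measurable_cfun_prod (I : Type) (s : seq I) (F : I -> T -> R[i]) :
  (forall i, measurable_cfun (F i)) ->
  measurable_cfun (fun w => \prod_(i <- s) F i w).
Proof.
move=> mF; elim: s => [|i s IH].
  under eq_fun do rewrite big_nil; exact: measurable_cfun_cst.
under eq_fun do rewrite big_cons; exact: measurable_cfunM.
Qed.

(** By the Leibniz formula, the determinant is a signed sum over permutations of products of
    entries. *)
Lemma measurable_cfun_det n (A : T -> 'M[R[i]]_n) :
  (forall i j, measurable_cfun (fun w => A w i j)) ->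
  measurable_cfun (fun w => \det (A w)).
Proof.
move=> mA; apply: measurable_cfun_sum => s.
apply: measurable_cfunM; first exact: measurable_cfun_cst.
by apply: measurable_cfun_prod => i.
Qed.

End complex_measurability.

(** * From a low rate to a small channel matrix; measurability of the rate *)

Section uplink.
Local Open Scope sesquilinear_scope.
Local Open Scope complex_scope.
Context {R : realType}.

(** The squared Frobenius norm, valued in [R] and split into real coordinates so that it can be
    compared with [real_coord]. *)
Definition frob_sqr {m n} (A : 'M[R[i]]_(m, n)) : R :=
  \sum_i \sum_j (complex.Re (A i j) ^+ 2 + complex.Im (A i j) ^+ 2).

Lemma mxtrace_gram_complex m n (A : 'M[R[i]]_(m, n)) :
  \tr (A *m A ^t*) = (frob_sqr A)%:C.
Proof.
rewrite /frob_sqr rmorph_sum; apply: eq_bigr => i _.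
rewrite mulmx_trC_diag rmorph_sum; apply: eq_bigr => j _.
by rewrite -add_Re2_Im2.
Qed.

Lemma real_coord_sqr_le_frob n k (A : 'M[R[i]]_(n, k)) (l : 'I_k) j :
  real_coord j (col l A) ^+ 2 <= frob_sqr A.
Proof.
have ge0 i l' : 0 <= complex.Re (A i l') ^+ 2 + complex.Im (A i l') ^+ 2.
  by rewrite addr_ge0 ?sqr_ge0.
rewrite /frob_sqr (bigD1 j.1)//= (bigD1 l)//= -addrA.
apply: (@le_trans _ _ (complex.Re (A j.1 l) ^+ 2 + complex.Im (A j.1 l) ^+ 2)).
  by rewrite /real_coord mxE; case: j.2; rewrite ?lerDl ?lerDr sqr_ge0.
by rewrite lerDl addr_ge0// ?sumr_ge0// => i _; rewrite sumr_ge0.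
Qed.

(** An inequality in [R[i]] means equal imaginary parts and ordered real parts; the second half is
    extracted from [det_1D_gram_ge]. *)
Lemma Re_det_1D_gram_ge m n (a : R) (A : 'M[R[i]]_(m, n)) : 0 <= a ->
  1 + a * frob_sqr A <= complex.Re (\det (1%:M + a%:C *: (A *m A ^t*))).
Proof.
move=> a0.
have := @det_1D_gram_ge R[i] m n a%:C A; rewrite ler0c => /(_ a0).
by rewrite mxtrace_gram_complex -rmorphM -[1]/(1%:C) -rmorphD lecE => /andP[].
Qed.

Lemma noise_var_ge1 M (RT : 'M[R[i]]_M) s : 1 <= noise_var RT s.
Proof.
rewrite /noise_var lerDl; case: ((_ *m _) 0 0) => x y /=; exact: sqrtr_ge0.
Qed.

(** An average of [L] nonnegative logarithms below [r] forces the logarithm of slot [l] below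
    [L%:R * r]. The factor 2^(L r) is written as [expR (L%:R * r * ln 2)]. *)
Lemma uplink_rate_lt_frob M N K L (RT : 'M[R[i]]_M) (S : 'M[R[i]]_(M, L))
    (A : 'M[R[i]]_(N, K)) (l : 'I_L) (r p : R) :
  0 < p -> uplink_rate RT S A p < r ->
  frob_sqr A <= expR (L%:R * r * ln 2) * noise_var RT (col l S) / p.
Proof.
move=> p0; set t := frob_sqr A.
have t0 : 0 <= t.
  by apply: sumr_ge0 => i _; apply: sumr_ge0 => j _; rewrite addr_ge0 ?sqr_ge0.
have L0 : 0 < L%:R :> R by rewrite ltr0n (leq_ltn_trans _ (ltn_ord l)).
have v0 s : 0 < noise_var RT s by exact: (lt_le_trans ltr01 (noise_var_ge1 _ _ _)).
have ln2 : 0 < ln 2 :> R by rewrite ln_gt0// ltr1n.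
rewrite /uplink_rate mulrC ltr_pdivrMr// => rate_lt.
pose D k := complex.Re
  (\det (1%:M + (p * (noise_var RT (col k S))^-1)%:C *: (A *m A ^t*))).
have D_ge k : 1 + p * (noise_var RT (col k S))^-1 * t <= D k.
  by apply: Re_det_1D_gram_ge; rewrite mulr_ge0 ?invr_ge0// ltW.
have D_ge1 k : 1 <= D k.
  by apply: le_trans (D_ge k); rewrite lerDl !mulr_ge0 ?invr_ge0// ltW.
have lnD_lt : ln (D l) < L%:R * r * ln 2.
  rewrite -ltr_pdivrMr// [ltRHS]mulrC; apply: le_lt_trans rate_lt.
  rewrite (bigD1 l)//= lerDl sumr_ge0// => k _.
  exact: divr_ge0 (ln_ge0 (D_ge1 k)) (ltW ln2).
(* The goal is rearranged so that the left side is the lower bound of [D l] without its summand 1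
   and the right side is the exponential bounding [D l]. *)
rewrite ler_pdivlMr// mulrC -ler_pdivrMr// mulrAC.
apply: le_trans (_ : D l <= _); first by apply: le_trans (D_ge l); rewrite lerDr.
have Dpos : D l \is Num.pos by rewrite posrE; exact: lt_le_trans ltr01 (D_ge1 l).
by rewrite -(lnK Dpos) ler_expR ltW.
Qed.

(** Each determinant is a polynomial in the entries of [Hu w] and their conjugates, followed by the
    real part and the logarithm. *)
Lemma measurable_uplink_rate d (T : measurableType d) M N K L
    (RT : 'M[R[i]]_M) (S : 'M[R[i]]_(M, L)) (Hu : T -> 'M[R[i]]_(N, K)) (p : R) :
  (forall k j, measurable_fun setT (fun w => real_coord j (col k (Hu w)))) ->
  measurable_fun setT (fun w => uplink_rate RT S (Hu w) p).
Proof.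
move=> mHu.
have mentry i k : measurable_cfun (fun w => Hu w i k).
  split; [move: (mHu k (i, false))|move: (mHu k (i, true))];
    by rewrite /real_coord/=; under eq_fun do rewrite mxE.
apply: measurable_funM; first exact: measurable_cst.
apply: measurable_sum => l; apply: measurable_funM; last exact: measurable_cst.
apply: measurableT_comp => //.
suff: measurable_cfun (fun w => \det (1%:M +
    (p * (noise_var RT (col l S))^-1)%:C *: (Hu w *m (Hu w) ^t*))) by case.
apply: measurable_cfun_det => i j.
under eq_fun do rewrite !mxE.
apply: measurable_cfunD; first exact: measurable_cfun_cst.
apply: measurable_cfunM; first exact: measurable_cfun_cst.
apply: measurable_cfun_sum => k; apply: measurable_cfunM => //.
under eq_fun do rewrite !mxE.
exact: measurable_cfun_conj.
Qed.

End uplink.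

Theorem theorem4 (d : measure_display) (T : measurableType d) (R : realType)
    (P : probability T R) (M N K L : nat)
    (M1 : (1 <= M)%N) (N1 : (1 <= N)%N) (K1 : (1 <= K)%N) (L1 : (1 <= L)%N)
    (KM : (K <= M)%N) (KN : (K <= N)%N) (ML : (M <= L)%N) (NL : (N <= L)%N)
    (RT : 'M[R[i]]_M) (RT_posdef : hermitian_posdef RT)
    (S : 'M[R[i]]_(M, L))
    (Hu : T -> 'M[R[i]]_(N, K))
    (Hu_normal : forall k : 'I_K,
      standard_complex_normal P (fun w => col k (Hu w)))
    (Hu_indep : mutually_independent P
      (fun k : 'I_K => g_sigma_cvect (fun w => col k (Hu w))))
    (r : R) (r_gt0 : 0 < r) :
  (uplink_outage P RT S Hu r : R -> R^o)
    =O_+oo (fun p : R => p ^- (N * K) : R^o).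
Proof.
(* The norm bound is read off at the first time slot; in outage it gives [frob_sqr] at most
   [C / p]. *)
pose l0 : 'I_L := Ordinal L1.
set C := expR (L%:R * r * ln 2) * noise_var RT (col l0 S).
set q := normal_peak (Num.sqrt (2^-1)) : R.
have C0 : 0 < C.
  by rewrite mulr_gt0 ?expR_gt0//; exact: lt_le_trans ltr01 (noise_var_ge1 _ _ _).
have q0 : 0 < q by exact: normal_peak_gt0.
have mHu k j : measurable_fun setT (fun w => real_coord j (col k (Hu w))).
  by have [+ _ _] := Hu_normal k; exact.
have mbox (c : R) k : measurable ((fun w => col k (Hu w)) @^-1` coord_box N c).
  rewrite preimage_coord_boxE; apply: fin_bigcap_measurable => // j _.
  rewrite -[X in measurable X]setTI; exact: mHu.
apply: (proj2 (@eqO_exP _ _ R^o R^o (pinfty_filter_on R) _ _)).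
(* With [c] the square root of [C / p], a coordinate lies in [[- c, c]] with probability at most
   [2 * c * q], whose square is [4 * q ^+ 2 * C / p]. The [2 * N * K] coordinates give the power
   [N * K] of this square. *)
exists ((4 * q ^+ 2 * C) ^+ (N * K)).
  by rewrite exprn_gt0 ?(mulr_gt0 _ C0) ?mulr_gt0 ?exprn_gt0 ?ltr0n.
apply: filterS (nbhs_pinfty_gt (real0 R)) => p p0.
set c := Num.sqrt (C / p).
have c2 : c ^+ 2 = C / p by rewrite sqr_sqrtr// divr_ge0 ?ltW.
(* [le_measure] below needs this: [P] is arbitrary off the measurable sets. *)
have moutage : measurable [set w | uplink_rate RT S (Hu w) p < r].
  rewrite (_ : [set w | _] =
      setT `&` (fun w => uplink_rate RT S (Hu w) p) @^-1` `]-oo, r[).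
    exact: measurable_uplink_rate.
  by apply/seteqP; split=> w /=; rewrite in_itv/= => // -[].
(* Outage places every column in the box of half-side [c]. The inner exponent counts the real
   coordinates of a column, the outer one the independent columns. *)
have out_le : (P [set w | (uplink_rate RT S (Hu w) p < r)%R] <=
    (((2 * c * q) ^+ (N * 2)) ^+ K)%:E)%E.
  apply: (@le_trans _ _
      (P (\bigcap_k ((fun w => col k (Hu w)) @^-1` coord_box N c)))).
    apply: le_measure; rewrite ?inE//.
      exact: fin_bigcap_measurable.
    move=> w /= rate_lt k _ j /=.
    have frob_le := uplink_rate_lt_frob _ _ _ _ _ _ _ l0 _ _ p0 rate_lt.
    rewrite -sqrtr_sqr ler_wsqrtr//.
    by apply: le_trans frob_le; exact: real_coord_sqr_le_frob.
  rewrite -[in leRHS](card_ord K).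
  apply: (mutually_independent_bigcap_le _ _ _ _ _ _ Hu_indep) => [|k|k].
  - by rewrite exprn_ge0// !mulr_ge0 ?sqrtr_ge0 ?normal_peak_ge0.
  - exact: g_sigma_cvect_coord_box.
  - by apply: standard_complex_normal_coord_box_le; rewrite ?sqrtr_ge0.
rewrite /uplink_outage ger0_norm ?fine_ge0// ger0_norm; last first.
  by rewrite invr_ge0 exprn_ge0// ltW.
have -> : (4 * q ^+ 2 * C) ^+ (N * K) * p ^- (N * K) = ((2 * c * q) ^+ (N * 2)) ^+ K.
  have cq2 : (2 * c * q) ^+ 2 = 4 * q ^+ 2 * C / p by rewrite !exprMn c2; ring.
  by rewrite mulnC [in RHS]mulnC !exprM cq2 -!exprM -exprVn -exprMn mulnC.
by rewrite -lee_fin fineK// fin_num_measure.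
Qed.
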